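(* Let $H$ be a finite dimensional real Hilbert space, $C\subseteq H$ a nonempty, convex and closed set, and $F:H\to H$ an operator such that the solution set $\Omega$ of $\mathrm{VI}(F,C)$ is nonempty. Assume that $F$ is pseudo-monotone on $C$ and Lipschitz continuous with constant $L>0$, and let $0<\lambda<\frac1L$. Let $(\rho_n)_{n\ge0}\subseteq[0,1]$ with $\liminf_{n\to+\infty}\rho_n>0$. Let $x_0\in H$ and let, for all $n\ge0$, $$y_n=P_C(x_n-\lambda F(x_n)),\qquad x_{n+1}=\rho_n\left(y_n+\lambda(F(x_n)-F(y_n))\right)+(1-\rho_n)x_n,$$ and assume that $x_n\ne y_n$ and $F(y_n)\neq0$ for every $n\ge0$. Then the sequence $(x_n)_{n\ge0}$ converges to a solution of $\mathrm{VI}(F,C)$.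
   Context: $\mathrm{VI}(F,C)$ is the problem of finding $x^*\in C$ such that $\langle F(x^* ),x-x^*\rangle\ge 0$ for all $x\in C$; $\Omega$ denotes its solution set. $P_C$ is the metric projection onto $C$. $F$ is pseudo-monotone on $C$ if for all $x,y\in C$: $\langle F(x),y-x\rangle\ge 0\Rightarrow\langle F(y),y-x\rangle\ge0$. $F$ is Lipschitz continuous with constant $L$ if $\|F(x)-F(y)\|\le L\|x-y\|$ for all $x,y\in H$. The iteration is Tseng's forward-backward-forward algorithm with relaxation parameters $(\rho_n)$; the algorithm stops if $y_n=x_n$ or $F(y_n)=0$, and the assumption that this never occurs means that it generates an infinite sequence. *)

(* Defs.v *)
From HB Require Import structures.
From mathcomp Require Import all_boot all_order all_algebra.
From mathcomp Require Import all_classical all_reals all_analysis.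

Set Implicit Arguments.
Unset Strict Implicit.
Unset Printing Implicit Defensive.

Import Order.TTheory GRing.Theory Num.Theory.
Import numFieldNormedType.Exports.

Local Open Scope classical_set_scope.
Local Open Scope ring_scope.

(* Over [idfun], [{dot T for idfun}] is the type of symmetric positive definite
   bilinear forms; the axiom below ties the form to the norm of [T], hence to
   its topology. *)
HB.mixin Record NormedModule_hasInner (R : realType) T
    of NormedModule R T := {
  inner : {dot T for (@idfun R)} ;
  inner_norm : forall x : T, inner x x = `|x| ^+ 2
}.

#[short(type="hilbertType")]
HB.structure Definition Hilbert (R : realType) :=
  {T of CompleteNormedModule R T & NormedModule_hasInner R T}.

#[short(type="finHilbertType")]
HB.structure Definition FinHilbert (R : realType) :=
  {T of Hilbert R T & Vector R T}.

Notation "''[' u , v ]" := (inner u v) (format "''[' u ,  v ]") : ring_scope.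

Section VariationalInequality.
Context {R : realType} {H : hilbertType R}.
Implicit Types (C : set H) (F : H -> H) (x y p : H).

Definition VI_solutions F C : set H :=
  [set p | C p /\ forall x, C x -> 0 <= '[F p, x - p]].

Definition pseudo_monotone_on C F :=
  forall x y, C x -> C y -> 0 <= '[F x, y - x] -> 0 <= '[F y, y - x].

Definition nearest_points C x : set H :=
  [set p | C p /\ forall z, C z -> `|x - p| <= `|x - z|].

(* The default value 0 is only taken when [x] has no nearest point in [C],
   which does not happen for a nonempty closed convex [C]. *)
Definition metric_projection C x : H := xget 0 (nearest_points C x).

End VariationalInequality.

(* Main.v *)
(** The point of the argument is that [x] is Fejér monotone with respect to the
    solution set.  If [p] is a solution, pseudo-monotonicity gives
    [0 <= '[F (y n), y n - p]], and together with the obtuse-angle inequality of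
    the projection this shows that the forward-backward-forward step decreases
    the squared distance to [p] by at least
    [(1 - (lam * L) ^+ 2) * `|x n - y n| ^+ 2]; relaxation multiplies this gain
    by [rho n].  Hence [x] is bounded and, as [rho] is eventually bounded away
    from 0, [x n - y n] tends to 0.  By compactness some subsequences of [x] and
    [y] share a limit [q]; passing to the limit in the projection inequality, [q]
    is a solution, and the distances to [q], being nonincreasing and small along
    a subsequence, tend to 0. *)

Require Import Defs.
From HB Require Import structures.
From mathcomp Require Import all_boot all_order all_algebra.
From mathcomp Require Import all_classical all_reals all_analysis.
From mathcomp Require Import ring lra.
Import Order.TTheory GRing.Theory Num.Theory.
Import numFieldNormedType.Exports.
Local Open Scope classical_set_scope.
Local Open Scope ring_scope.

Set Implicit Arguments.
Unset Strict Implicit.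
Unset Printing Implicit Defensive.

(** * Compactness of closed balls in finite dimension *)

Section FiniteDimension.
Import VectorInternalTheory.
Context {R : realType} {H : finHilbertType R}.

(** The structure of [H] does not tie its norm to coordinates. Continuity here and the lower bound
    below compare the two, so that compactness can be carried over from row vectors. *)
Lemma r2v_continuous : continuous (r2v : 'rV[R]_(dim H) -> H).
Proof.
apply/linear_bounded_continuous/linear_boundedP.
pose K := \sum_(i < dim H) `|r2v (delta_mx 0 i : 'rV[R]_(dim H)) : H|.
near=> r => v; apply: (@le_trans _ _ (K * `|v|)).
  rewrite [v in leLHS]row_sum_delta linear_sum.
  rewrite (le_trans (ler_norm_sum _ _ _))// mulr_suml ler_sum// => i _.
  rewrite linearZ/= normrZ mulrC ler_wpM2l//.
  rewrite [leRHS]/Num.norm/= mx_normrE.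
  exact: (le_bigmax _ (fun ij => `|v ij.1 ij.2|) (0, i)).
by rewrite ler_wpM2r//; near: r; apply: nbhs_pinfty_ge; rewrite num_real.
Unshelve. all: by end_near. Qed.

(** The norm of [r2v v] attains its minimum on the compact unit sphere, and injectivity of [r2v]
    makes it positive; homogeneity does the rest. *)
Lemma r2v_norm_lower_bound :
  exists2 m : R, 0 < m &
    forall v : 'rV[R]_(dim H), m * `|v| <= `|r2v v : H|.
Proof.
pose S := [set v : 'rV[R]_(dim H) | `|v| = 1].
have toS v : v != 0 -> S (`|v|^-1 *: v).
  by move=> v0; rewrite /S/= normrZ normfV normr_id mulVf// normr_eq0.
(* The sphere is empty when [dim H] is 0; then every [v] is 0 and any constant works. *)
have [[s Ss]|S0] := pselect (S !=set0); last first.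
  exists 1 => // v; have [->|v0] := eqVneq v 0; first by rewrite normr0 mulr0.
  by exfalso; apply: S0; exists (`|v|^-1 *: v); exact: toS.
have cS : compact S.
  apply: bounded_closed_compact.
    by exists 1; split => // M M1 v /= ->; exact: ltW.
  rewrite (_ : S = Num.norm @^-1` [set 1]); last by [].
  apply: preimage_closed; last exact: closed_eq.
  by move=> v _; exact: norm_continuous.
have [|c cS' cmin] := @compact_EVT_min _ R
  (fun v : 'rV[R]_(dim H) => `|r2v v : H|) S (ex_intro _ s Ss) cS.
  apply: continuous_subspaceT => v.
  exact: cvg_norm (@r2v_continuous v).
exists `|r2v c : H|.
  rewrite normr_gt0; apply: contraTneq cS' => r2vc0.
  rewrite notin_setE /S/= -(r2vK c) r2vc0 linear0 normr0 => /eqP.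
  by rewrite eq_sym oner_eq0.
move=> v; have [->|v0] := eqVneq v 0; first by rewrite normr0 mulr0.
have := cmin _ (mem_set (toS _ v0)).
by rewrite linearZ/= normrZ normfV normr_id mulrC ler_pdivlMr ?normr_gt0.
Qed.

(** By the lower bound, the ball is a closed subset of the image under [r2v] of a compact ball. *)
Lemma closed_ball_compact (a : H) (e : R) :
  compact (closed_ball_ Num.norm a e).
Proof.
have [m m0 mP] := r2v_norm_lower_bound.
pose B := [set v : 'rV[R]_(dim H) | `|v| <= (`|a| + e) / m].
have cB : compact B.
  apply: bounded_closed_compact.
    exists ((`|a| + e) / m); split; first exact: num_real.
    by move=> M lM v /= /le_trans; apply; exact: ltW.
  rewrite (_ : B = Num.norm @^-1` [set x | x <= (`|a| + e) / m]); last by [].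
  apply: preimage_closed; last exact: closed_le.
  by move=> v _; exact: norm_continuous.
apply: (subclosed_compact (@closed_closed_ball_ R H a e)
  (continuous_compact (continuous_subspaceT (@r2v_continuous)) cB)).
move=> x; rewrite /closed_ball_/= => xe.
exists (v2r x); last by rewrite v2rK.
rewrite /B/= ler_pdivlMr// mulrC (le_trans (mP _))// v2rK.
by have := ler_normB a (a - x); rewrite subKr; lra.
Qed.

End FiniteDimension.

(** * Inner product identities and inequalities *)

Section InnerProduct.
Context {R : realType} {H : hilbertType R}.
Implicit Types (u v w x y p : H) (a : R).

Lemma innerC u v : '[u, v] = '[v, u].
Proof. by rewrite hermC/= expr0 mul1r. Qed.

Lemma innerDl u v w : '[u + v, w] = '[u, w] + '[v, w].
Proof. exact: linearDl. Qed.

Lemma innerNl u w : '[- u, w] = - '[u, w].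
Proof. exact: linearNl. Qed.

Lemma innerZl a u w : '[a *: u, w] = a * '[u, w].
Proof. exact: linearZl_LR. Qed.

Lemma innerDr u v w : '[w, u + v] = '[w, u] + '[w, v].
Proof. exact: linearDr. Qed.

Lemma innerNr u w : '[w, - u] = - '[w, u].
Proof. exact: linearNr. Qed.

Lemma innerZr a u w : '[w, a *: u] = a * '[w, u].
Proof. exact: linearZr. Qed.

Definition innerE :=
  (innerDl, innerNl, innerZl, innerDr, innerNr, innerZr).

Lemma normD_sqr u v : `|u + v| ^+ 2 = `|u| ^+ 2 + 2 * '[u, v] + `|v| ^+ 2.
Proof. by rewrite -!inner_norm !innerE (innerC v u); ring. Qed.

Lemma inner_polarization u v : '[u, v] = (`|u + v| ^+ 2 - `|u - v| ^+ 2) / 4.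
Proof. by rewrite !normD_sqr innerNr normrN; field. Qed.

(** Polarization reduces joint continuity of the form to continuity of the norm. *)
Lemma cvg_inner (T : Type) (G : set_system T) (FG : Filter G) (f g : T -> H)
    (u v : H) : f @ G --> u -> g @ G --> v ->
  '[f t, g t] @[t --> G] --> '[u, v].
Proof.
move=> fu gv; rewrite inner_polarization.
under eq_fun do rewrite inner_polarization.
apply: cvgMr_tmp; apply: cvgB.
- exact: cvg_comp (cvg_norm (cvgD fu gv)) (@exprn_continuous _ 2 _).
- exact: cvg_comp (cvg_norm (cvgB fu gv)) (@exprn_continuous _ 2 _).
Qed.

Lemma norm_convex_combination_sqr a u v : 0 <= a <= 1 ->
  `|a *: u + (1 - a) *: v| ^+ 2 <= a * `|u| ^+ 2 + (1 - a) * `|v| ^+ 2.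
Proof.
move=> /andP[a0 a1]; rewrite -subr_ge0.
have -> : a * `|u| ^+ 2 + (1 - a) * `|v| ^+ 2 -
    `|a *: u + (1 - a) *: v| ^+ 2 = a * (1 - a) * `|u - v| ^+ 2.
  by rewrite -!inner_norm !innerE (innerC v u); ring.
by rewrite !mulr_ge0// subr_ge0.
Qed.

Lemma nearest_point_obtuse (C : set H) x p z :
  convex_set (C : set (convex_lmodType H)) -> nearest_points C x p -> C z ->
  '[x - p, z - p] <= 0.
Proof.
move=> Cconv [Cp pmin] Cz; rewrite leNgt; apply/negP.
set s := '[x - p, z - p] => s0.
have N0 : 0 <= `|z - p| ^+ 2 by [].
(* Moving from [p] towards [z] by [t] changes the squared distance to [x] by $-2ts + t^2\|z-p\|^2$.
   The extra [s] in the denominator keeps [t] in [0, 1], and the change becomes $-ts(1+t) < 0$,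
   against minimality of [p]. *)
set t := s / (s + `|z - p| ^+ 2).
have tN : t * (s + `|z - p| ^+ 2) = s by rewrite /t divfK// gt_eqF//; lra.
have t01 : 0 <= t <= 1.
  by rewrite /t divr_ge0 ?ler_pdivrMr/=; lra.
have Ct : C (t *: z + (1 - t) *: p).
  have /andP[t0 t1] := t01.
  have := Cconv z p (Itv01 t0 t1).
  by rewrite !inE; apply.
have := pmin _ Ct; rewrite -ler_sqr ?nnegrE//.
have -> : `|x - (t *: z + (1 - t) *: p)| ^+ 2 =
    `|x - p| ^+ 2 - 2 * t * s + t ^+ 2 * `|z - p| ^+ 2.
  rewrite /s -!inner_norm !innerE (innerC z x) (innerC p x) (innerC p z).
  ring.
nra.
Qed.

(* Here [f] and [g] stand for [F x] and [F y].  Adding the two inner-product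
   hypotheses gives [0 <= '[x - z, y - p]] for [z = y + lam *: (f - g)]. *)
Lemma forward_backward_forward_decrease (lam L : R) x y p f g :
  0 <= lam -> 0 <= '[x - lam *: f - y, y - p] -> 0 <= '[g, y - p] ->
  `|f - g| <= L * `|x - y| ->
  `|y + lam *: (f - g) - p| ^+ 2 <=
    `|x - p| ^+ 2 - (1 - (lam * L) ^+ 2) * `|x - y| ^+ 2.
Proof.
move=> lam0 proj mono lip.
have : lam ^+ 2 * `|f - g| ^+ 2 <= lam ^+ 2 * (L * `|x - y|) ^+ 2.
  by rewrite ler_wpM2l ?sqr_ge0// ler_sqr ?nnegrE// (le_trans _ lip).
have := mulr_ge0 lam0 mono; move: proj.
(* With [z] the new point, $\|x-p\|^2 - \|z-p\|^2 = \|x-y\|^2 + 2\langle x-z, y-p\rangle -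
   \lambda^2\|f-g\|^2$. *)
rewrite !exprMn -!inner_norm !innerE.
rewrite (innerC y x) (innerC p x) (innerC p y) (innerC f y) (innerC f p).
rewrite (innerC g y) (innerC g p) (innerC g f).
lra.
Qed.

End InnerProduct.

(** The distance to [x] is minimized over the compact part of [C] no farther from [x] than some [c]
    in [C]; the other points of [C] are farther than [c]. *)
Lemma metric_projectionP (R : realType) (H : finHilbertType R) (C : set H)
    (x : H) :
  C !=set0 -> closed C -> nearest_points C x (metric_projection C x).
Proof.
move=> [c Cc] clC; apply: xgetPex.
pose K := C `&` closed_ball_ Num.norm x `|x - c|.
have cK : compact K.
  apply: (subclosed_compact _ (@closed_ball_compact _ _ x _) (@subIsetr _ C _)).
  exact: closedI clC (@closed_closed_ball_ _ _ _ _).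
have Kc : K c by split => //; rewrite /closed_ball_/=.
have [|p Kp pmin] := @compact_EVT_min _ R (fun z => `|x - z|) K
  (ex_intro _ c Kc) cK.
  by apply: continuous_subspaceT => z; apply: cvg_norm; apply: cvgB;
    [exact: cvg_cst|exact: cvg_id].
move: Kp; rewrite inE => -[Cp px].
exists p; split => // z Cz; have [zx|xz] := leP `|x - z| `|x - c|.
  by apply: pmin; rewrite inE; split.
exact: le_trans px (ltW xz).
Qed.

(** * Limits of sequences *)

Lemma limn_inf_gt0 (R : realType) (u : nat -> R) :
  bounded_fun u -> 0 < limn_inf u ->
  exists2 r : R, 0 < r & \forall n \near \oo, r <= u n.
Proof.
move=> bu; rewrite limn_infE// => u0.
have hs : has_sup (range (infs u)).
  split; first by exists (infs u 0%N); exists 0%N.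
  exact: bounded_fun_has_ubound_infs.
(* Taking the supremum itself as the margin yields a tail with positive infimum. *)
have [_ [N _ <-]] := sup_adherent u0 hs; rewrite subrr => infs0.
exists (infs u N) => //; exists N => // n /= Nn.
apply: ge_inf; last by exists n.
have [m mP] := bounded_fun_has_lbound bu.
by exists m => _ [k _ <-]; apply: mP; exists k.
Qed.

(** The bound [k <= phi k] makes [phi] tend to infinity, which is what limits along [phi] use;
    [phi k] picks a term within 1/(k+1) of a cluster point. *)
Lemma compact_cvg_subsequence (R : realType) (V : normedModType R) (K : set V)
    (u : nat -> V) : compact K -> (forall n, K (u n)) ->
  exists2 q, K q & exists2 phi : nat -> nat,
    (forall k, k <= phi k)%N & u (phi k) @[k --> \oo] --> q.
Proof.
move=> cK Ku.
have [q [Kq clq]] : K `&` cluster (u @ \oo) !=set0.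
  apply: cK.
  by exists 0%N => // n _; exact: Ku.
exists q => //.
have near_q (k : nat) : exists n, (k <= n)%N /\ `|q - u n| < k.+1%:R^-1.
  have uk : nbhs (u @ \oo) [set v | exists2 n, (k <= n)%N & v = u n].
    by exists k => // n /= kn; exists n.
  have := clq _ _ uk (nbhsx_ballx q (k.+1%:R^-1) (ltac:(by rewrite invr_gt0))).
  by move=> [_ [[n kn ->]]]; rewrite -ball_normE => qn; exists n.
have [phi phiP] := choice near_q.
exists phi; first by move=> k; have [] := phiP k.
apply/cvgrPdist_lt => e e0.
apply: filterS (near_infty_natSinv_lt (PosNum e0)) => k /=.
by apply: lt_trans; have [] := phiP k.
Qed.

Lemma nonincreasing_dist_cvg (R : realType) (V : normedModType R)
    (u : nat -> V) (phi : nat -> nat) (q : V) :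
  (forall n, `|u n.+1 - q| <= `|u n - q|) ->
  u (phi k) @[k --> \oo] --> q -> u n @[n --> \oo] --> q.
Proof.
move=> dec /cvgrPdist_lt phiq.
have mono n m : (n <= m)%N -> `|u m - q| <= `|u n - q|.
  by move=> /subnK <-; elim: (m - n)%N => // k /(le_trans (dec _)).
apply/cvgrPdist_lt => e e0; have [k _ /(_ k (leqnn k))/= uk] := phiq _ e0.
exists (phi k) => // n /= kn.
by rewrite distrC (le_lt_trans (mono _ _ kn))// distrC.
Qed.

Theorem theorem3p2 (R : realType) (H : finHilbertType R)
    (C : set H) (F : H -> H) (L lam : R) (rho : nat -> R)
    (x0 : H) (x y : nat -> H)
    (C_neq0 : C !=set0)
    (C_convex : convex_set (C : set (convex_lmodType H)))
    (C_closed : closed C)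
    (Omega_neq0 : VI_solutions F C !=set0)
    (F_pseudo_monotone : pseudo_monotone_on C F)
    (L_gt0 : 0 < L)
    (F_lipschitz : L.-lipschitz F)
    (lam_gt0 : 0 < lam)
    (lam_lt : lam < 1 / L)
    (rho_01 : forall n, 0 <= rho n <= 1)
    (liminf_rho : 0 < limn_inf rho)
    (x_init : x 0%N = x0)
    (y_step : forall n, y n = metric_projection C (x n - lam *: F (x n)))
    (x_step : forall n,
       x n.+1 = rho n *: (y n + lam *: (F (x n) - F (y n)))
                + (1 - rho n) *: x n)
    (no_stop : forall n, x n <> y n /\ F (y n) <> 0) :
  exists2 p : H, VI_solutions F C p & x n @[n --> \oo] --> p.
Proof.
have Flip u v : `|F u - F v| <= L * `|u - v| by exact: (F_lipschitz (u, v)).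
have yP n : nearest_points C (x n - lam *: F (x n)) (y n).
  by rewrite y_step; exact: metric_projectionP.
have yC n : C (y n) by have [] := yP n.
have obtuse n z : C z -> '[x n - lam *: F (x n) - y n, z - y n] <= 0.
  exact: nearest_point_obtuse C_convex (yP n).
set c := 1 - (lam * L) ^+ 2.
have c_gt0 : 0 < c.
  have : lam * L < 1 by rewrite -ltr_pdivlMr.
  by rewrite subr_gt0 expr_lt1// mulr_ge0// ltW.
have fejer p n : VI_solutions F C p ->
    `|x n.+1 - p| ^+ 2 <= `|x n - p| ^+ 2 - rho n * (c * `|x n - y n| ^+ 2).
  move=> [Cp pP].
  have proj : 0 <= '[x n - lam *: F (x n) - y n, y n - p].
    by rewrite -(opprB p) innerNr oppr_ge0 obtuse.
  have mono : 0 <= '[F (y n), y n - p].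
    by apply: F_pseudo_monotone => //; exact: pP.
  have := forward_backward_forward_decrease (ltW lam_gt0) proj mono (Flip _ _).
  rewrite x_step -/c; set z := y n + _ => zp.
  have -> : rho n *: z + (1 - rho n) *: x n - p =
      rho n *: (z - p) + (1 - rho n) *: (x n - p).
    by rewrite !scalerBr addrACA -opprD -scalerDl (addrC (rho n)) subrK scale1r.
  (* Convexity of the squared norm passes the decrease to the relaxed step, scaled by [rho n]. *)
  apply: le_trans (norm_convex_combination_sqr _ _ (rho_01 n)) _.
  have /andP[rho_ge0 _] := rho_01 n.
  have := ler_wpM2l rho_ge0 zp.
  lra.
have dec p : VI_solutions F C p -> forall n, `|x n.+1 - p| <= `|x n - p|.
  move=> pP n; rewrite -ler_sqr ?nnegrE// (le_trans (fejer _ n pP))//.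
  have /andP[rho_ge0 _] := rho_01 n.
  by rewrite gerBl mulr_ge0// mulr_ge0// ltW.
have [p0 p0P] := Omega_neq0.
have xy0 : (x n - y n) @[n --> \oo] --> (0 : H).
  have brho : bounded_fun rho.
    exists 1; split => // M M1 n _ /=; have /andP[rho_ge0 rho_le1] := rho_01 n.
    by rewrite ger0_norm// (le_trans rho_le1)// ltW.
  have [r r_gt0 rP] := limn_inf_gt0 brho liminf_rho.
  pose d n := `|x n - p0| ^+ 2.
  have d_cvg : cvgn d.
    apply: nonincreasing_is_cvgn.
      apply/nonincreasing_seqP => n.
      by rewrite ler_sqr ?nnegrE//; exact: dec.
    by exists 0 => _ [n _ <-]; exact: sqr_ge0.
  (* Consecutive differences of the convergent [d] vanish; once [rho n] is at least [r], this
     multiple of them dominates the squared residual. *)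
  have diff0 : (r * c)^-1 * (d n - d n.+1) @[n --> \oo] --> (0 : R).
    rewrite -(mulr0 (r * c)^-1) -(subrr (limn d)).
    by apply: cvgMl_tmp; apply: cvgB => //; rewrite (cvg_shiftS d).
  have sq0 : `|x n - y n| ^+ 2 @[n --> \oo] --> (0 : R).
    apply: squeeze_cvgr (cvg_cst 0) diff0.
    near=> n; rewrite sqr_ge0/= ler_pdivlMl ?mulr_gt0//.
    have rn : r <= rho n by near: n.
    have := fejer _ n p0P; rewrite -/(d n) -/(d n.+1).
    have : 0 <= (rho n - r) * (c * `|x n - y n| ^+ 2).
      by rewrite mulr_ge0 ?subr_ge0// mulr_ge0// ltW.
    lra.
  apply/cvgrPdist_lt => e e_gt0.
  move/cvgrPdist_lt : sq0 => /(_ _ (exprn_gt0 2 e_gt0)).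
  apply: filterS => n; rewrite !sub0r !normrN.
  by rewrite ger0_norm ?sqr_ge0// ltr_sqr ?nnegrE// ltW.
have xK n : closed_ball_ Num.norm p0 `|x 0%N - p0| (x n).
  rewrite /closed_ball_/= distrC.
  by elim: n => // n; exact: le_trans (dec _ p0P _).
have [q _ [phi phi_ge phi_cvg]] :=
  compact_cvg_subsequence (@closed_ball_compact _ _ p0 _) xK.
have xyphi0 : (x (phi k) - y (phi k)) @[k --> \oo] --> (0 : H).
  apply: (cvg_comp phi (fun n => x n - y n)) xy0 => A [N _ NA].
  by exists N => // k /= Nk; apply: NA; exact: leq_trans Nk (phi_ge k).
have yphi : y (phi k) @[k --> \oo] --> q.
  rewrite -(subr0 q).
  under eq_fun => k do rewrite -[y _](subKr (x (phi k))).
  exact: cvgB.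
have Fphi : F (x (phi k)) @[k --> \oo] --> F q.
  apply/cvgrPdist_lt => e e_gt0.
  move/cvgrPdist_lt : phi_cvg => /(_ _ (divr_gt0 e_gt0 L_gt0)).
  apply: filterS => k; rewrite ltr_pdivlMr// mulrC; exact: le_lt_trans.
have qP : VI_solutions F C q.
  (* Membership of [q] in [C] comes from the projected points [y (phi k)], since [x (phi k)] may lie
     outside [C]. *)
  split; first by apply: (closed_cvg _ C_closed) yphi; exact: nearW.
  move=> z Cz.
  (* As the residual vanishes, the obtuse-angle inequality keeps only its [F] term in the limit;
     dividing by [- lam] gives the variational inequality at [q]. *)
  have lim : '[x (phi k) - y (phi k) - lam *: F (x (phi k)), z - y (phi k)]
      @[k --> \oo] --> '[0 - lam *: F q, z - q].
    apply: cvg_inner; last by apply: cvgB => //; exact: cvg_cst.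
    by apply: cvgB => //; exact: cvgZl_tmp.
  have : '[0 - lam *: F q, z - q] <= 0.
    apply: (closed_cvg _ (@closed_le R 0)) lim.
    by apply: nearW => k /=; rewrite addrAC; exact: obtuse.
  by rewrite sub0r innerNl innerZl oppr_le0 pmulr_rge0.
by exists q => //; exact: nonincreasing_dist_cvg (dec q qP) phi_cvg.
Unshelve. all: by end_near. Qed.
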